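(* Let $X_1,\dots,X_n$ be i.i.d. real random variables whose common distribution is symmetric about $\mu\in\mathbb{R}$ and satisfies $\mathbb{E}\big[|X_1-\mathbb{E}X_1|^{1+a}\big]=M<\infty$ for some $a\in(0,1]$. Take $m=2$, let $k\le n$ be an integer, $\tilde n=\lfloor n/k\rfloor$, let $R(\theta)$ be the one-sided resampled median-of-means rank defined in the context, and $U=\sup\{\theta: R(\theta)=1\}$. Then $$\mathbb{P}\Big(U-\mu>4(12M)^{1/(1+a)}\Big(\frac{1}{\tilde n}\Big)^{\frac{a}{1+a}}\Big)\le 2k\exp(-\tilde n/8)+2\exp(-k/8).$$
   Context: Blocks: for $\ell=1,\dots,k$ let $B_\ell=\{i\in[n]: i\equiv \ell \pmod k\}$. Median: for reals $y_1,\dots,y_k$ with order statistics $y_{(1)}\le\dots\le y_{(k)}$, $\mathrm{med}(y_1,\dots,y_k)=y_{(k/2)}$ if $k$ is even and $y_{(\lfloor k/2\rfloor+1)}$ if $k$ is odd. Median-of-means: $\widehat\mu(x_1,\dots,x_n)=\mathrm{med}\big(\frac{1}{|B_1|}\sum_{i\in B_1}x_i,\dots,\frac{1}{|B_k|}\sum_{i\in B_k}x_i\big)$. Randomization: $\alpha_{1,1},\dots,\alpha_{n,1}$ i.i.d. Rademacher signs independent of the data; $\pi$ a uniformly random permutation of $\{0,1\}$ independent of data and signs. For $\theta\in\mathbb{R}$: $\mathcal{D}_0(\theta)=(X_1,\dots,X_n)$, $\mathcal{D}_1(\theta)=(\alpha_{1,1}(X_1-\theta)+\theta,\dots,\alpha_{n,1}(X_n-\theta)+\theta)$;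 $S_j(\theta)=\widehat\mu(\mathcal{D}_j(\theta))-\theta$ for $j=0,1$. $S_0(\theta)\prec_\pi S_1(\theta)$ iff $S_0(\theta)<S_1(\theta)$, or $S_0(\theta)=S_1(\theta)$ and $\pi(0)<\pi(1)$. $R(\theta)=1+\mathbb{I}\big(S_0(\theta)\prec_\pi S_1(\theta)\big)$. The supremum of the empty set is $-\infty$. *)

(* Defs.v *)
From HB Require Import structures.
From mathcomp Require Import all_boot all_order all_algebra all_fingroup.
From mathcomp Require Import all_classical all_reals all_analysis.
Set Implicit Arguments. Unset Strict Implicit. Unset Printing Implicit Defensive.
Import Order.TTheory GRing.Theory Num.Theory.
Local Open Scope classical_set_scope.
Local Open Scope ring_scope.

Section defs.
Variable R : realType.

(* median: y_(k/2) if k even, y_(floor(k/2)+1) if k odd (1-based order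
   statistics); here 0-based indices into the sorted list *)
Definition med (s : seq R) : R :=
  let k := size s in
  nth 0 (sort <=%R s) (if odd k then k./2 else (k./2).-1).

(* index i : 'I_n stands for i+1 in [n];  B_l = {i in [n] : i = l mod k} *)
Definition in_block (n k l : nat) (i : 'I_n) : bool := (i.+1 %% k == l %% k)%N.

Definition block_mean (n k l : nat) (x : 'I_n -> R) : R :=
  (\sum_(i < n | in_block k l i) x i) / (#|[set i : 'I_n | in_block k l i]|)%:R.

Definition mom (n k : nat) (x : 'I_n -> R) : R :=
  med [seq block_mean k l x | l <- iota 1 k].

Definition D0 (n : nat) (X : 'I_n -> R) (theta : R) : 'I_n -> R := X.
Definition D1 (n : nat) (X alpha : 'I_n -> R) (theta : R) : 'I_n -> R :=
  fun i => alpha i * (X i - theta) + theta.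

Definition S0 n k (X : 'I_n -> R) theta : R := mom k (D0 X theta) - theta.
Definition S1 n k (X alpha : 'I_n -> R) theta : R := mom k (D1 X alpha theta) - theta.

Definition precpi (s0 s1 : R) (pi : {perm 'I_2}) : bool :=
  (s0 < s1) || ((s0 == s1) && (pi ord0 < pi ord_max)%N).

Definition rank n k (X alpha : 'I_n -> R) (pi : {perm 'I_2}) (theta : R) : nat :=
  (1 + precpi (S0 k X theta) (S1 k X alpha theta) pi)%N.

(* U = sup {theta : R(theta) = 1}, in the extended reals (sup of empty = -oo) *)
Definition Usup n k (X alpha : 'I_n -> R) (pi : {perm 'I_2}) : \bar R :=
  ereal_sup [set theta%:E | theta in [set theta : R | rank k X alpha pi theta = 1%N]].

End defs.

(* Mutual independence of X_1..X_n, alpha_1..alpha_n, pi: product rule for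
   all events (taking full sets recovers every subfamily). *)
Definition mutually_independent d (T : measurableType d) (R : realType)
  (P : probability T R) (n : nat) (X alpha : 'I_n -> T -> R)
  (pi : T -> {perm 'I_2}) : Prop :=
  forall (B C : 'I_n -> set R) (A : set {perm 'I_2}),
    (forall i, measurable (B i)) -> (forall i, measurable (C i)) ->
    P ((\bigcap_i (X i @^-1` B i)) `&` (\bigcap_i (alpha i @^-1` C i))
        `&` (pi @^-1` A)) =
    ((\prod_(i < n) P (X i @^-1` B i)) * (\prod_(i < n) P (alpha i @^-1` C i))
      * P (pi @^-1` A))%E.

(* Main.v *)
(** Write [Y i = X i - mu]; symmetry gives [E X = mu], so [E |Y|^(1+a) = M], and
    let [c] be a quarter of the deviation in the theorem.  If some
    [theta > mu + 4 c] has rank 1 then [mom (D1 theta) <= mom X].  A block mean of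
    [D1 theta] is the block mean of [alpha Y] plus
    [mu + (theta - mu) (1 - mean alpha)], so when every block mean of [alpha] is at
    most 1/2 this forces [mom Y > c] or [mom (alpha Y) < - c].
    - Some block mean of [alpha] exceeds 1/2 with probability at most
      [k exp (- (n %/ k) / 8)], by a Chernoff bound.
    - By symmetry [Y], [alpha Y] and [- alpha Y] have the same law, also
      conditionally on [alpha], so the other two events are bounded by the
      probability that at least half of the [k] block means of [Y] exceed [c].
      Averaging over independent sign vectors, one for each block, and using
      Chebyshev's inequality under these signs, this is at most
      [2^-k E (prod_i (1 + 3 w (Y i)))] with [w y = min 1 (y^2 / t^2)], where [t] is
      [c] times the size of the block; as [w y <= |y|^(1+a) / t^(1+a)], independence
      bounds it by [exp (- k / 8)]. *)

Require Import Defs.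
From HB Require Import structures.
From mathcomp Require Import all_boot all_order all_algebra all_fingroup.
From mathcomp Require Import all_classical all_reals all_analysis.
From mathcomp Require Import measurable_realfun.
From mathcomp Require Import ring lra zify.
Set Implicit Arguments.
Unset Strict Implicit.
Import Order.TTheory GRing.Theory Num.Theory.
Import numFieldNormedType.Exports.
Local Open Scope classical_set_scope.
Local Open Scope ring_scope.

(** * Medians and block means *)

Definition midx (k : nat) : nat := if odd k then k./2 else (k./2).-1.

Lemma midx_lt k : (0 < k)%N -> (midx k < k)%N.
Proof. by rewrite /midx => k0; case: ifP => ok; lia. Qed.

(** With the next lemma, this is all that the parity convention must deliver: when the median
    crosses a threshold, at least half of the entries do, in either direction. *)
Lemma midx_compl k c c' :
  (c <= midx k)%N -> (c + c')%N = k -> (0 < k)%N -> (k <= 2 * c')%N.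
Proof. by rewrite /midx; case: ifP => ok; lia. Qed.

Lemma midx_lt_double k c : (midx k < c)%N -> (k <= 2 * c)%N.
Proof. by rewrite /midx; case: ifP => ok; lia. Qed.

(** Split the list after position [r]: if that entry is at most [c], the whole first part is
    counted; otherwise neither that entry nor anything in the second part is. *)
Lemma sorted_nth_le (R : realType) (t : seq R) r c :
  sorted <=%R t -> (r < size t)%N ->
  (nth 0 t r <= c) = (r < count (fun y => (y <= c)%R) t)%N.
Proof.
move=> st rt; have le_nth : {in [pred i | (i < size t)%N] &,
    {homo nth 0 t : i j / (i <= j)%N >-> i <= j}}.
  exact: sorted_leq_nth le_trans le_refl _ _ st.
have -> : count (fun y => (y <= c)%R) t =
    (count (fun y => (y <= c)%R) (take r.+1 t) + count (fun y => (y <= c)%R) (drop r.+1 t))%N.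
  by rewrite -count_cat cat_take_drop.
have sr : size (take r.+1 t) = r.+1 by rewrite size_takel.
case: (leP (nth 0 t r) c) => h.
  rewrite (_ : count _ (take _ _) = r.+1); first by rewrite addSn ltnS leq_addr.
  rewrite -[RHS]sr; apply/eqP; rewrite -all_count; apply/(all_nthP 0) => i.
  rewrite sr => ir; rewrite nth_take//; apply: le_trans h.
  by apply: le_nth; rewrite ?inE; lia.
apply/esym/negbTE; rewrite -leqNgt.
rewrite (_ : count _ (drop _ _) = 0%N).
  rewrite addn0 (take_nth 0)// -cats1 count_cat/= leNgt h/= !addn0.
  by rewrite (leq_trans (count_size _ _))// size_takel// ltnW.
apply/eqP; rewrite -leqn0 leqNgt -has_count; apply/hasPn => x.
move=> /(nthP 0)[i]; rewrite size_drop => ir <-; rewrite nth_drop -ltNge.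
apply: (lt_le_trans h); apply: le_nth; rewrite ?inE /= -?ltn_subRL//.
by rewrite ltnW// ltn_addr.
Qed.

(** Trades order statistics for a count, which is blind to the order of the list; later comparisons
    of a median with a threshold go through it. *)
Lemma med_le (R : realType) (s : seq R) c : (0 < size s)%N ->
  (med s <= c) = (midx (size s) < count (fun y => (y <= c)%R) s)%N.
Proof.
move=> s0; rewrite /med -/(midx _) sorted_nth_le ?size_sort ?midx_lt//.
  by congr (_ < _)%N; apply/seq.permP; rewrite perm_sort.
exact/sort_sorted/le_total.
Qed.

(** An index whose [g] value is at most the median of [g] has its [f] value at most that median plus
    [e], so the count can only grow. *)
Lemma med_map_leD (R : realType) (I : eqType) (s : seq I) (f g : I -> R) e :
  (0 < size s)%N -> (forall l, l \in s -> f l <= g l + e) ->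
  med [seq f l | l <- s] <= med [seq g l | l <- s] + e.
Proof.
move=> s0 fg; rewrite med_le ?size_map//.
have : med [seq g l | l <- s] <= med [seq g l | l <- s] by [].
rewrite [in X in X -> _]med_le ?size_map// => /leq_trans; apply.
rewrite !count_map; move: (med _) => m.
elim: s {s0} fg => //= l s IH fg; apply: leq_add; last first.
  by apply: IH => j js; apply: fg; rewrite inE js orbT.
case: (leP (g l) m) => //= glm; rewrite (le_trans (fg l _)) ?mem_head//.
by rewrite lerD2r.
Qed.

Lemma med_gt_count (R : realType) (s : seq R) c : (0 < size s)%N ->
  c < med s -> (size s <= 2 * count (fun y => (c < y)%R) s)%N.
Proof.
move=> s0; rewrite ltNge med_le// -leqNgt => h.
have := count_predC (fun y => (y <= c)%R) s.
rewrite (@eq_count _ (predC (fun y => (y <= c)%R)) (fun y => (c < y)%R)); last first.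
  by move=> y /=; rewrite ltNge.
by move=> /(midx_compl h); exact.
Qed.

Lemma med_lt_count (R : realType) (s : seq R) c : (0 < size s)%N ->
  med s < c -> (size s <= 2 * count (fun y => (y < c)%R) s)%N.
Proof.
move=> s0 mc; have : med s <= med s by [].
rewrite [in X in X -> _]med_le// => h.
have : (count (fun y => (y <= med s)%R) s <= count (fun y => (y < c)%R) s)%N.
  by apply: sub_count => y /= /le_lt_trans; apply.
by move=> /(leq_trans h); exact: midx_lt_double.
Qed.

Section blocks.
Context {R : realType}.
Implicit Types (n k l : nat).

Definition block_card n k l : nat := #|[pred i : 'I_n | in_block k l i]|.

Lemma block_meanE n k l (x : 'I_n -> R) :
  block_mean k l x = (\sum_(i < n | in_block k l i) x i) / (block_card n k l)%:R.
Proof.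
rewrite /block_mean /block_card; congr (_ / _%:R); apply: eq_card => i.
by apply/idP/idP => [/set_mem|h]; [|exact/mem_set].
Qed.

(** The 1-based labels of indices and of blocks are both shifted by one, and the shifts cancel;
    block [k] becomes the residue [k - 1]. *)
Lemma in_blockE n k (l : 'I_k) (i : 'I_n) :
  in_block k l.+1 i = (i %% k == l)%N.
Proof.
rewrite /in_block -!(addn1 (nat_of_ord _)) eqn_modDr.
by rewrite [X in _ == X](modn_small (ltn_ord l)).
Qed.

(** The indices [l + j * k] with [j < n %/ k] are distinct members of the block. *)
Lemma block_card_ge n k (l : 'I_k) : (n %/ k <= block_card n k l.+1)%N.
Proof.
have k0 : (0 < k)%N by exact: leq_ltn_trans (ltn_ord l).
have h (j : 'I_(n %/ k)) : (l + j * k < n)%N.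
  have := ltn_ord j; have := ltn_ord l; have := leq_trunc_div n k; nia.
rewrite -[X in (X <= _)%N]card_ord /block_card.
rewrite -(card_imset (f := fun j => Ordinal (h j))); last first.
  move=> i j [] /eqP; rewrite eqn_add2l eqn_pmul2r// => /eqP ij.
  exact/val_inj.
apply/subset_leq_card/fintype.subsetP => i /imsetP[j _ ->].
by rewrite inE in_blockE/= addnC modnMDl modn_small.
Qed.

Lemma momE n k (x : 'I_n -> R) :
  mom k x = med [seq block_mean k l.+1 x | l : 'I_k <- enum 'I_k].
Proof.
rewrite /mom -[1%N]/(1 + 0)%N iotaDl -map_comp -val_enum_ord -map_comp.
by [].
Qed.

Definition bad_blocks n k (d : R) (x : 'I_n -> R) : nat :=
  \sum_(l < k) (d < block_mean k l.+1 x)%R.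

Lemma mom_gt n k (x : 'I_n -> R) d : (0 < k)%N -> d < mom k x ->
  (k <= 2 * bad_blocks k d x)%N.
Proof.
move=> k0; rewrite momE => /med_gt_count.
rewrite size_map size_enum_ord => /(_ k0).
by rewrite count_map -sum1_count big_mkcond/= big_enum/=.
Qed.

Lemma block_meanN n k l (x : 'I_n -> R) :
  block_mean k l (fun i => - x i) = - block_mean k l x.
Proof. by rewrite !block_meanE sumrN mulNr. Qed.

(** Expressing lower deviations through the negated sample leaves a single upper tail to bound. *)
Lemma mom_lt n k (x : 'I_n -> R) d : (0 < k)%N -> mom k x < - d ->
  (k <= 2 * bad_blocks k d (fun i => (- x i)%R))%N.
Proof.
move=> k0; rewrite momE => /med_lt_count.
rewrite size_map size_enum_ord => /(_ k0).
rewrite count_map -sum1_count big_mkcond/= big_enum/=.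
rewrite /bad_blocks; under [in X in _ -> X]eq_bigr do rewrite block_meanN ltrNr.
by [].
Qed.

Lemma mom_leD n k (x y : 'I_n -> R) e : (0 < k)%N ->
  (forall l : 'I_k, block_mean k l.+1 x <= block_mean k l.+1 y + e) ->
  mom k x <= mom k y + e.
Proof.
by move=> k0 h; rewrite !momE; apply: med_map_leD; rewrite ?size_enum_ord.
Qed.

End blocks.

(** * Laws on finite products *)

Definition vectors (R : realType) (n : nat) : Type := 'I_n -> R.

HB.instance Definition _ (R : realType) (n : nat) := gen_eqMixin (vectors R n).
HB.instance Definition _ (R : realType) (n : nat) := gen_choiceMixin (vectors R n).
HB.instance Definition _ (R : realType) (n : nat) :=
  isPointed.Build (vectors R n) (fun=> 0).

Section laws.
Context {R : realType} {n : nat}.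

(** The pi-system of measurable rectangles, which generates the product sigma-algebra. *)
Definition boxes : set (set (vectors R n)) :=
  [set A | exists2 B : 'I_n -> set R, (forall i, measurable (B i)) &
     A = [set y | forall i, B i (y i)]].

Lemma boxes_setI : setI_closed boxes.
Proof.
move=> _ _ [B mB ->] [C mC ->]; exists (fun i => B i `&` C i).
  by move=> i; exact: measurableI.
apply/seteqP; split => y /=; first by move=> [By Cy] i; split.
by move=> h; split => i; have [] := h i.
Qed.

Local Notation vec := (g_sigma_algebraType boxes).

Lemma measurable_coord (i : 'I_n) :
  measurable_fun setT (fun y : vec => y i).
Proof.
move=> _ B mB; rewrite setTI; apply: sub_sigma_algebra.
exists (fun j => if j == i then B else setT).
  by move=> j; case: ifP.
apply/seteqP; split => y /=; last by move=> /(_ i); rewrite eqxx.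
by move=> By j; case: eqP => // ->.
Qed.

Lemma measurable_vector d (T : measurableType d) (Z : 'I_n -> T -> R)
    (G : set vec) :
  (forall i, measurable_fun setT (Z i)) -> measurable G ->
  measurable [set w | G (fun i => Z i w)].
Proof.
move=> mZ mG; pose f : T -> vec := fun w i => Z i w.
have mf : measurable_fun setT f.
  apply: (@measurability _ _ T vec setT f boxes) => //.
  move=> _ [_ [B mB ->] <-].
  rewrite setTI (_ : f @^-1` _ = \bigcap_(i in setT) (Z i @^-1` B i)); last first.
    apply/seteqP; split => w /=; first by move=> h i _; exact: h.
    by move=> h i; exact: h.
  apply: fin_bigcap_measurable => [|i _]; first exact: finite_finset.
  by rewrite -[X in measurable X]setTI; exact: mZ.
by have := mf measurableT G mG; rewrite setTI.
Qed.

(** Dynkin's pi-lambda theorem. The event [A] and the factor [c], which must equal [P A], make it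
    usable for conditional laws. *)
Lemma law_unique d (T : measurableType d) (P : probability T R)
    (A : set T) (Z Z' : 'I_n -> T -> R) (c : R) :
  measurable A -> (forall i, measurable_fun setT (Z i)) ->
  (forall i, measurable_fun setT (Z' i)) ->
  (forall B : 'I_n -> set R, (forall i, measurable (B i)) ->
    P (A `&` \bigcap_i (Z i @^-1` B i)) =
    (c%:E * P (\bigcap_i (Z' i @^-1` B i)))%E) ->
  forall G : set vec, measurable G ->
    P (A `&` [set w | G (fun i => Z i w)]) =
    (c%:E * P [set w | G (fun i => Z' i w)])%E.
Proof.
move=> mA mZ mZ' ZZ' G mG.
have mAZ (S : set vec) : measurable S ->
    measurable (A `&` [set w | S (fun i => Z i w)]).
  by move=> mS; apply: measurableI => //; exact: measurable_vector.
have PA : P A = c%:E.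
  have := ZZ' (fun=> setT) (fun=> measurableT).
  have cT (W : 'I_n -> T -> R) : \bigcap_i (W i @^-1` [set: R]) = [set: T].
    exact/seteqP.
  by rewrite !cT setIT probability_setT mule1.
have c0 : 0 <= c by rewrite -lee_fin -PA.
pose Q (S : set vec) := P (A `&` [set w | S (fun i => Z i w)]) =
    (c%:E * P [set w | S (fun i => Z' i w)])%E.
apply: (@dynkin_induction _ vec boxes Q) => //.
- exact: boxes_setI.
- have allT (f : T -> vec) : [set w | [set: vec] (f w)] = setT by [].
  by rewrite /Q !allT setIT probability_setT mule1.
- move=> _ [B mB ->]; rewrite /Q.
  have boxE (W : 'I_n -> T -> R) :
      [set w | [set y : vec | forall i, B i (y i)] (W^~ w)] =
      \bigcap_i (W i @^-1` B i).
    by apply/seteqP; split => w /= h i; [move=> _; exact: h|exact: (h i I)].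
  by rewrite !boxE ZZ'.
- move=> S mS; rewrite /Q => QS.
  have -> : A `&` [set w | (~` S) (fun i => Z i w)] =
      A `\` (A `&` [set w | S (fun i => Z i w)]).
    by rewrite setDIr setDv set0U setDE.
  have -> : P (A `\` (A `&` [set w | S (fun i => Z i w)])) =
      (P A - P (A `&` [set w | S (fun i => Z i w)]))%E.
    rewrite measureD//; [by rewrite setIA setIid|exact: mAZ|].
    exact: le_lt_trans (probability_le1 P mA) (ltry 1).
  rewrite QS PA.
  have -> : [set w | (~` S) (fun i => Z' i w)] = ~` [set w | S (fun i => Z' i w)] by [].
  rewrite probability_setC; last exact: measurable_vector.
  by rewrite muleBr// mule1.
- move=> F mF tF QF; rewrite /Q.
  have -> : A `&` [set w | (\bigcup_k F k) (fun i => Z i w)] =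
      \bigcup_k (A `&` [set w | F k (fun i => Z i w)]).
    by rewrite -setI_bigcupr.
  have -> : [set w | (\bigcup_k F k) (fun i => Z' i w)] =
      \bigcup_k [set w | F k (fun i => Z' i w)] by [].
  rewrite !measure_bigcup//; last 4 first.
  + by move=> k _; exact: measurable_vector.
  + apply/trivIsetP => i j _ _ ij; rewrite -subset0 => w [/= a b].
    by have /trivIsetP/(_ i j I I ij) := tF; rewrite -subset0; apply; split; eauto.
  + by move=> k _; exact: mAZ.
  + apply/trivIsetP => i j _ _ ij; rewrite -subset0 => w [/= [_ a] [_ b]].
    by have /trivIsetP/(_ i j I I ij) := tF; rewrite -subset0; apply; split; eauto.
  by rewrite -nneseriesZl//; apply: eq_eseriesr => k _; exact: QF.
Qed.

End laws.

(** * Measurability of the event *)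

Section measurability.
Context {R : realType} d (T : measurableType d).
Local Notation mfun := (measurable_fun (setT : set T)).

Lemma measurable_bool_set (b : T -> bool) : mfun b -> measurable [set w | b w].
Proof.
move=> mb; rewrite (_ : [set w | b w] = setT `&` b @^-1` [set true]).
  exact: mb.
by rewrite setTI; apply/seteqP; split => w /=.
Qed.

Lemma measurable_lt_set (f g : T -> R) : mfun f -> mfun g ->
  measurable [set w | f w < g w].
Proof. by move=> mf mg; apply/measurable_bool_set/measurable_fun_ltr. Qed.

Lemma measurable_bool_sum (I : Type) (s : seq I) (b : I -> T -> bool) :
  (forall i, mfun (b i)) -> mfun (fun w => \sum_(i <- s) (b i w : nat))%N.
Proof.
move=> mb; elim: s => [|i s IH].
  by under eq_fun do rewrite big_nil; exact: measurable_cst.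
under eq_fun do rewrite big_cons; apply: measurable_fun_addn => //.
by apply: (@measurableT_comp _ _ _ _ _ _ nat_of_bool).
Qed.

Lemma measurable_med (I : Type) (s : seq I) (f : I -> T -> R) :
  (0 < size s)%N -> (forall i, mfun (f i)) ->
  mfun (fun w => med [seq f i w | i <- s]).
Proof.
move=> s0 mf.
apply: (measurability _ (RGenOInfty.measurableE R)).
move=> _ [_ [c ->] <-]; rewrite setTI.
have cE w : count (fun y => (y <= c)%R) [seq f i w | i <- s] =
    (\sum_(i <- s) (f i w <= c)%R)%N.
  by rewrite count_map -sum1_count big_mkcond.
rewrite (_ : _ @^-1` _ = ~` [set w |
    (midx (size s) < \sum_(i <- s) (f i w <= c)%R)%N]); last first.
  by apply/seteqP; split => w /=; rewrite in_itv/= andbT ltNge med_le ?size_map//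
    cE => /negP.
apply: measurableC; apply: measurable_bool_set; apply: measurable_fun_ltn.
  exact: measurable_cst.
by apply: measurable_bool_sum => i; apply: measurable_fun_ler.
Qed.

Lemma measurable_block_mean n k l (x : 'I_n -> T -> R) :
  (forall i, mfun (x i)) -> mfun (fun w => block_mean k l (x^~ w)).
Proof.
move=> mx; under eq_fun do rewrite block_meanE -big_filter.
apply: measurable_funM; last exact: measurable_cst.
exact: measurable_sum.
Qed.

Lemma measurable_mom n k (x : 'I_n -> T -> R) : (0 < k)%N ->
  (forall i, mfun (x i)) -> mfun (fun w => mom k (x^~ w)).
Proof.
move=> k0 mx; under eq_fun do rewrite momE.
apply: measurable_med; first by rewrite size_enum_ord.
by move=> l; exact: measurable_block_mean.
Qed.

(** A strict inequality for a continuous function persists nearby, so a rational parameter can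
    replace [t]. *)
Lemma measurable_exists_gt (h : T -> R -> R) (c : R) :
  (forall t, mfun (h^~ t)) -> (forall w, continuous (h w)) ->
  measurable [set w | exists2 t, c < t & 0 < h w t].
Proof.
move=> mh ch.
rewrite (_ : [set w | _] = \bigcup_(q : rat)
    [set w | c < ratr q /\ 0 < h w (ratr q)]); last first.
  apply/seteqP; split => w /=; last by move=> [q _ [/= cq hq]]; exists (ratr q).
  move=> [t ct ht].
  have [|x [[/= cx hx] [q _ qx]]] :=
    @dense_rat R ([set x | c < x] `&` (h w @^-1` [set y | 0 < y]))
      (ex_intro _ t (conj ct ht)).
    apply: openI; first exact: open_gt.
    by apply: open_comp => [x _|]; [exact: ch|exact: open_gt].
  by exists q => //=; rewrite qx.
apply: bigcupT_measurable_rat => q.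
case: (ltP c (ratr q)) => cq; last first.
  rewrite (_ : [set w | _] = set0)//.
  by apply/seteqP; split => w //= -[].
rewrite (_ : [set w | _] = [set w | 0 < h w (ratr q)]).
  by apply: measurable_lt_set.
by apply/seteqP; split => w //= -[].
Qed.

(* Rational parameters are clamped to [[a, b]] so that the endpoints need no
   separate treatment. *)
Lemma measurable_exists_itv (h : T -> R -> R) (a b : R) : a <= b ->
  (forall t, mfun (h^~ t)) -> (forall w, continuous (h w)) ->
  measurable [set w | exists2 t, t \in `[a, b] & 0 <= h w t].
Proof.
move=> ab mh ch; pose cl (t : R) := Num.max a (Num.min b t).
have clab t : cl t \in `[a, b].
  by rewrite in_itv/= /cl le_max lexx/= ge_max ab ge_min lexx.
have cl_id t : t \in `[a, b] -> cl t = t.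
  by rewrite in_itv/= /cl => /andP[at_ tb]; rewrite min_r// max_r.
have ccl : continuous cl.
  move=> x; apply: continuous_max; first exact: cst_continuous.
  by apply: continuous_min; [exact: cst_continuous|exact: cvg_id].
(* A weak inequality may fail at every rational parameter; it is replaced by strict lower bounds
   that tend to 0. *)
rewrite (_ : [set w | _] = \bigcap_(m : nat) \bigcup_(q : rat)
    [set w | - m.+1%:R^-1 < h w (cl (ratr q))]).
  apply: bigcapT_measurable => m; apply: bigcupT_measurable_rat => q.
  by apply: measurable_lt_set.
apply/seteqP; split => w /=.
  move=> [t tab ht] m _.
  have [||x [/= hx [q _ qx]]] := @dense_rat R
    ((h w \o cl) @^-1` [set y | - m.+1%:R^-1 < y]).
  - exists t => /=; rewrite cl_id//; apply: lt_le_trans ht.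
    by rewrite oppr_lt0 invr_gt0.
  - apply: open_comp => [x _|]; last exact: open_gt.
    by apply: continuous_comp; [exact: ccl|exact: ch].
  - by exists q => //=; rewrite qx.
(* The maximum over the compact interval is the witness: were it negative, a rational point would
   exceed it for large [m]. *)
move=> H; have [|t tab tmax] := @EVT_max R (h w) a b ab.
  exact/continuous_subspaceT.
exists t => //; rewrite leNgt; apply/negP => ht.
have := H (Num.truncn (- h w t)^-1) I => -[q _ /=].
apply/negP; rewrite -leNgt (le_trans (tmax _ (clab _)))// lerNr.
rewrite -[X in _ <= X]invrK lef_pV2 ?posrE ?invr_gt0 ?oppr_gt0//.
by rewrite ltW// truncnS_gt.
Qed.

(** Exhausts the open half-line by compact intervals, to which the previous lemma applies. *)
Lemma measurable_exists_ge (h : T -> R -> R) (c : R) :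
  (forall t, mfun (h^~ t)) -> (forall w, continuous (h w)) ->
  measurable [set w | exists2 t, c < t & 0 <= h w t].
Proof.
move=> mh ch; rewrite (_ : [set w | _] = \bigcup_(j : nat)
  [set w | exists2 t, t \in `[c + j.+1%:R^-1, c + j.+1%:R] & 0 <= h w t]).
  apply: bigcupT_measurable => j; apply: measurable_exists_itv => //.
  by rewrite lerD2l (@le_trans _ _ 1) ?invf_le1 ?ler1n.
apply/seteqP; split => w /=; last first.
  move=> [j _ [t]]; rewrite in_itv/= => /andP[h1 _] ht; exists t => //.
  by apply: lt_le_trans h1; rewrite ltrDl invr_gt0.
move=> [t ct ht]; rewrite -subr_gt0 in ct.
(* The sum of both integer parts makes [j.+1] exceed [t - c] and its inverse. *)
exists (Num.truncn (t - c) + Num.truncn (t - c)^-1)%N => //; exists t => //.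
have s1 := truncnS_gt (t - c); have s2 := truncnS_gt (t - c)^-1.
rewrite in_itv/= -lerBrDl -[X in _ && X]lerBlDl; apply/andP; split.
  rewrite -[X in _ <= X]invrK lef_pV2 ?posrE ?invr_gt0//.
  by apply: (le_trans (ltW s2)); rewrite ler_nat ltnS leq_addl.
by apply: (le_trans (ltW s1)); rewrite ler_nat ltnS leq_addr.
Qed.

End measurability.

(** The strict inequality passes to a member of the set, so the empty set needs no special case. *)
Lemma Usup_gtP (R : realType) n k (x s : 'I_n -> R) (p : {perm 'I_2}) (mu c : R) :
  (c%:E < Usup k x s p - mu%:E)%E <->
  exists2 t, mu + c < t & ~~ precpi (S0 k x t) (S1 k x s t) p.
Proof.
rewrite lteBrDr// -EFinD addrC; split.
  move=> /ereal_sup_gt[_ [t /= tr <-]]; rewrite lte_fin => ct; exists t => //.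
  by move: tr; rewrite /rank; case: precpi.
move=> [t ct tp]; apply: (@lt_le_trans _ _ t%:E); first by rewrite lte_fin.
by apply: ereal_sup_ubound; exists t => //=; rewrite /rank (negbTE tp).
Qed.

Lemma block_mean_D1 (R : realType) n k l (x s : 'I_n -> R) (t u : R) :
  block_mean k l (D1 x s t) = block_mean k l (D1 x s u) +
    (t - u) * block_mean k l (fun i => 1 - s i).
Proof.
rewrite !block_meanE mulrA -mulrDl mulr_sumr -big_split/=; congr (_ / _).
by apply: eq_bigr => i _; rewrite /D1; ring.
Qed.

(** Block means of [D1] are affine in the parameter with slopes bounded by [L], so [mom_leD] makes
    the map Lipschitz. *)
Lemma continuous_mom_D1 (R : realType) n k (x s : 'I_n -> R) : (0 < k)%N ->
  continuous (fun t => mom k (D1 x s t)).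
Proof.
move=> k0 u; pose L := \sum_(l < k) `|block_mean k l.+1 (fun i => 1 - s i)|.
have L0 : 0 <= L by apply: sumr_ge0.
have mom_lip t v : mom k (D1 x s t) <= mom k (D1 x s v) + `|t - v| * L.
  apply: mom_leD => // l; rewrite (block_mean_D1 _ _ _ _ t v) lerD2l.
  apply: le_trans (ler_norm _) _; rewrite normrM ler_wpM2l//.
  by rewrite /L (bigD1 l)//= lerDl sumr_ge0.
apply/cvgrPdist_lt => e e0; near=> t.
have tu : `|u - t| * L < e.
  apply: (@le_lt_trans _ _ (`|u - t| * (L + 1))).
    by rewrite ler_wpM2l// lerDl.
  rewrite -ltr_pdivlMr ?ltr_wpDl//; near: t.
  by apply: cvgr_dist_lt; rewrite ?divr_gt0 ?ltr_wpDl//; exact: cvg_id.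
have h1 := mom_lip t u; have h2 := mom_lip u t; rewrite distrC in h1.
by rewrite ltr_norml; apply/andP; split; lra.
Unshelve. all: by end_near. Qed.

(** With [h = S0 - S1], rank 1 means [0 < h] on the event [O], where a tie counts as [S0] preceding
    [S1], and [0 <= h] off it. *)
Lemma measurable_Usup_gt (R : realType) d (T : measurableType d) n k
    (X alpha : 'I_n -> T -> R) (pi : T -> {perm 'I_2}) (mu c : R) :
  (0 < k)%N ->
  (forall i, measurable_fun setT (X i)) ->
  (forall i, measurable_fun setT (alpha i)) ->
  (forall A : set {perm 'I_2}, measurable (pi @^-1` A)) ->
  measurable [set w |
    (c%:E < Usup k (fun i => X i w) (fun i => alpha i w) (pi w) - mu%:E)%E].
Proof.
move=> k0 mX malpha mpi.
pose h w t := mom k (X^~ w) - mom k (D1 (X^~ w) (alpha^~ w) t).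
have mh t : measurable_fun setT (h^~ t).
  apply: measurable_funB; first exact: measurable_mom.
  apply: (@measurable_mom _ _ _ _ _ (fun i w => alpha i w * (X i w - t) + t)) => // i.
  apply: measurable_funD => //; apply: measurable_funM => //.
  exact: measurable_funB.
have ch w : continuous (h w).
  by move=> u; apply: cvgB; [exact: cvg_cst|exact: continuous_mom_D1].
pose O := pi @^-1` [set p : {perm 'I_2} | (p ord0 < p ord_max)%N].
rewrite (_ : [set w | _] =
    (O `&` [set w | exists2 t, mu + c < t & 0 < h w t]) `|`
    (~` O `&` [set w | exists2 t, mu + c < t & 0 <= h w t])).
  apply: measurableU; apply: measurableI.
  - exact: mpi.
  - exact: measurable_exists_gt.
  - by apply: measurableC; exact: mpi.
  - exact: measurable_exists_ge.
have hE w t : S0 k (X^~ w) t - S1 k (X^~ w) (alpha^~ w) t = h w t.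
  by rewrite /S0 /S1 /D0 /h; ring.
apply/seteqP; split => w.
  move=> /Usup_gtP[t ct]; rewrite /precpi negb_or -leNgt negb_and => /andP[le01].
  rewrite eq_le le01 andbT; have [piw|piw] := boolP (_ < _)%N.
    rewrite orbF -ltNge -subr_gt0 hE => ht.
    by left; split => //; exists t.
  move=> _; right; split; first by rewrite /O/=; apply/negP.
  by exists t => //; rewrite -hE subr_ge0.
move=> H; apply/Usup_gtP; case: H => -[/= piw [t ct ht]]; exists t => //.
  rewrite -hE subr_gt0 in ht.
  by rewrite /precpi ltNge ltW//= negb_and gt_eqF.
rewrite -hE subr_ge0 in ht.
by rewrite /precpi ltNge ht/= negb_and; apply/orP; right; apply/negP.
Qed.

(** * Uniform random signs *)

Section signs.
Context {R : realType}.

Definition sgn (b : bool) : R := (-1) ^+ b.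

Lemma sgn_sqr b : sgn b ^+ 2 = 1.
Proof. by rewrite /sgn sqrr_sign. Qed.

Lemma card_signs n : #|{: {ffun 'I_n -> bool}}| = (2 ^ n)%N.
Proof. by rewrite card_ffun card_bool card_ord. Qed.

(** Flipping the sign at [i] permutes the sign vectors and negates every summand. *)
Lemma sum_sgn_cross n (i j : 'I_n) : i != j ->
  \sum_(tau : {ffun 'I_n -> bool}) sgn (tau i) * sgn (tau j) = 0.
Proof.
move=> ij; set S := LHS.
pose flip (tau : {ffun 'I_n -> bool}) := [ffun l => tau l (+) (l == i)].
have flipK : involutive flip.
  by move=> tau; apply/ffunP => l; rewrite !ffunE addbK.
suff : S = - S by lra.
rewrite /S [LHS](reindex_inj (inv_inj flipK)) -sumrN; apply: eq_bigr => tau _.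
rewrite !ffunE eqxx (negbTE (_ : j != i)) 1?eq_sym// addbF addbT.
by rewrite /sgn signrN mulNr.
Qed.

Lemma sum_sgn_sqr n (b : pred 'I_n) (y : 'I_n -> R) :
  \sum_(tau : {ffun 'I_n -> bool}) (\sum_(i | b i) sgn (tau i) * y i) ^+ 2 =
  2 ^+ n * \sum_(i | b i) y i ^+ 2.
Proof.
under eq_bigr do rewrite expr2 big_distrlr/=.
rewrite exchange_big mulr_sumr; apply: eq_bigr => i bi.
rewrite exchange_big (bigD1 i)//= [X in _ + X]big1 ?addr0.
  under eq_bigr do rewrite -expr2 exprMn sgn_sqr mul1r.
  by rewrite sumr_const card_signs -[LHS]mulr_natl natrX.
move=> j /andP[_ ji]; under eq_bigr do rewrite mulrACA.
by rewrite -mulr_suml sum_sgn_cross ?mul0r// eq_sym.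
Qed.

(* At [t = 0] this is the indicator of [y != 0], as Rocq's division gives
   [0 / 0 = 0]; the degenerate case [M = 0] thus needs no separate tail bound. *)
Definition truncsq (t y : R) : R := if y ^+ 2 <= t ^+ 2 then y ^+ 2 / t ^+ 2 else 1.

Lemma truncsq_ge0 t y : 0 <= truncsq t y.
Proof. by rewrite /truncsq; case: ifP => // _; rewrite divr_ge0// sqr_ge0. Qed.

Lemma truncsq_le1 t y : truncsq t y <= 1.
Proof.
rewrite /truncsq; case: ifP => // yt.
have [->|t0] := eqVneq t 0; first by rewrite expr0n/= invr0 mulr0.
by rewrite ler_pdivrMr ?mul1r// exprn_even_gt0.
Qed.

(* Chebyshev's inequality under uniform random signs, the event
   [exists i, t < `|y i|] being handled separately. *)
Lemma sgn_tail n (b : pred 'I_n) (y : 'I_n -> R) t : 0 <= t ->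
  \sum_(tau : {ffun 'I_n -> bool})
    ((t < \sum_(i | b i) sgn (tau i) * y i)%R : nat)%:R <=
  2 ^+ n * \sum_(i | b i) truncsq t (y i).
Proof.
move=> t0; have [[i /andP[bi yi]]|yt] :=
  pselect (exists i, b i && (t ^+ 2 < y i ^+ 2)).
  apply: (@le_trans _ _ (\sum_(tau : {ffun 'I_n -> bool}) 1)).
    by apply: ler_sum => tau _; case: (_ < _).
  rewrite sumr_const card_signs natrX ler_peMr ?exprn_ge0//.
  rewrite (bigD1 i)//= {1}/truncsq ifN -?ltNge// lerDl sumr_ge0// => j _.
  exact: truncsq_ge0.
have {}yt i : b i -> y i ^+ 2 <= t ^+ 2.
  by move=> bi; rewrite leNgt; apply/negP => yi; apply: yt; exists i; rewrite bi.
have -> : \sum_(i | b i) truncsq t (y i) = (\sum_(i | b i) y i ^+ 2) / t ^+ 2.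
  by rewrite mulr_suml; apply: eq_bigr => i bi; rewrite /truncsq yt.
rewrite mulrA -sum_sgn_sqr mulr_suml; apply: ler_sum => tau _.
set S := \sum_(i | b i) _.
have [tS|_] := ltP t S; last by rewrite divr_ge0// sqr_ge0.
(* With [t = 0] every selected [y i] is zero, so the sum cannot exceed [t]. *)
move: t0; rewrite le_eqVlt => /orP[/eqP t0|t0].
  move: tS; rewrite /S big1 ?t0 ?ltxx// => i bi.
  have := yt i bi; rewrite -t0 expr0n/= => yi0.
  have /eqP : y i ^+ 2 = 0 by apply/eqP; rewrite eq_le yi0 sqr_ge0.
  by rewrite sqrf_eq0 => /eqP ->; rewrite mulr0.
rewrite ler_pdivlMr ?exprn_gt0// mul1r lerXn2r ?nnegrE//; last exact: ltW.
  exact: ltW.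
exact: ltW (lt_trans t0 tS).
Qed.

(** For [x] in the unit interval, [x] rounded up to a multiple of [D%:R^-1]. It is written with
    indicators because independence is given for events: products of such sums expand into
    probabilities of boxes. *)
Definition gridup (D : nat) (x : R) : R :=
  D%:R^-1 * \sum_(m < D) ((m%:R / D%:R < x)%R : nat)%:R.

Lemma gridup_bounds D x : (0 < D)%N -> 0 <= x <= 1 ->
  x <= gridup D x <= x + D%:R^-1.
Proof.
move=> D0 /andP[x0 x1]; have D0' : 0 < D%:R :> R by rewrite ltr0n.
pose S m : R := \sum_(j < m) ((j%:R < D%:R * x)%R : nat)%:R.
(* [S m] is the smaller of [m] and of [D%:R * x] rounded up; the third bound feeds the induction for
   the second. *)
have HS m : [/\ Num.min (D%:R * x) m%:R <= S m, S m <= D%:R * x + 1 & S m <= m%:R].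
  have z0 : 0 <= D%:R * x by rewrite mulr_ge0// ler0n.
  elim: m => [|m [IH1 IH2 IH3]].
    by rewrite /S big_ord0 ge_min lexx orbT addr_ge0.
  rewrite /S big_ord_recr/= -/(S m); case: (ltP m%:R (D%:R * x)) => mz /=.
    rewrite -natr1 ge_min lerD2r; split; last by rewrite lerD2r.
      by apply/orP; right; move: IH1; rewrite min_r// ltW.
    by rewrite lerD2r (le_trans IH3)// ltW.
  rewrite addr0; split => //; last by rewrite (le_trans IH3)// ler_nat.
  move: IH1; rewrite !min_l//; by rewrite (le_trans mz)// ler_nat.
have -> : gridup D x = D%:R^-1 * S D.
  congr (_ * _); apply: eq_bigr => m _.
  by rewrite ltr_pdivrMr// [x * _]mulrC.
have [h1 h2 _] := HS D.
rewrite ![_^-1 * _]mulrC ler_pdivlMr// ler_pdivrMr// mulrDl mulVf ?gt_eqF// mulrC.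
rewrite h2 andbT; move: h1; rewrite min_l//.
by rewrite ler_piMr// ler0n.
Qed.

Definition block_of n k (k0 : (0 < k)%N) (i : 'I_n) : 'I_k :=
  Ordinal (ltn_pmod i k0).

Lemma block_ofE n k (k0 : (0 < k)%N) (i : 'I_n) (l : 'I_k) :
  in_block k l.+1 i = (block_of k0 i == l).
Proof. by rewrite in_blockE. Qed.

Lemma mean_gt n k l (y : 'I_n -> R) d : (0 < block_card n k l)%N ->
  (d < block_mean k l y) =
  ((block_card n k l)%:R * d < \sum_(i < n | in_block k l i) y i).
Proof. by move=> c0; rewrite block_meanE ltr_pdivlMr ?ltr0n// mulrC. Qed.

(** Weierstrass' product inequality; it turns a bound additive over a block into one factor per
    observation. *)
Lemma prod1D_ge (I : finType) (b : pred I) (z : I -> R) :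
  (forall i, 0 <= z i) -> 1 + \sum_(i | b i) z i <= \prod_(i | b i) (1 + z i).
Proof.
move=> z0; rewrite [X in 1 + X]big_mkcond [X in _ <= X]big_mkcond.
elim: (index_enum I) => [|i s IH]; first by rewrite !big_nil addr0.
rewrite !big_cons/=; case: ifP => _; last by rewrite add0r mul1r.
apply: (@le_trans _ _ ((1 + z i) * (1 + \sum_(j <- s) if b j then z j else 0))).
  have : 0 <= \sum_(j <- s) (if b j then z j else 0).
    by apply: sumr_ge0 => j _; case: ifP.
  by have := z0 i; nra.
by rewrite ler_wpM2l// addr_ge0.
Qed.

(* Every block receives its own sign vector, so that the average over the
   signs factors over the blocks. *)
Definition flip n k (k0 : (0 < k)%N) (sigma : {ffun 'I_k -> {ffun 'I_n -> bool}})
    (i : 'I_n) : bool := sigma (block_of k0 i) i.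

(** If [m] blocks are bad, [k <= 2 * m] gives [1 <= 2 ^- k * 4 ^+ m], and [4 ^+ m] is the product
    over blocks of [F], which is 4 on a bad block and 1 otherwise. The average of each factor is
    bounded by [sgn_tail]. *)
Lemma sum_bad_flip n k (k0 : (0 < k)%N) (y : 'I_n -> R) d : (k <= n)%N ->
  0 <= d ->
  \sum_(sigma : {ffun 'I_k -> {ffun 'I_n -> bool}})
    ((k <= 2 * bad_blocks k d (fun i => (sgn (flip k0 sigma i) * y i)%R))%N : nat)%:R <=
  2 ^- k * (2 ^+ n) ^+ k * \prod_(i < n)
    (1 + 3 * truncsq ((block_card n k (block_of k0 i).+1)%:R * d) (y i)).
Proof.
move=> kn d0; pose N l := block_card n k l.
have N0 (l : 'I_k) : (0 < N l.+1)%N.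
  by apply: leq_trans (block_card_ge n l); rewrite divn_gt0.
pose F (l : 'I_k) (tau : {ffun 'I_n -> bool}) : R :=
  1 + 3 * ((d < block_mean k l.+1 (fun i => sgn (tau i) * y i))%R : nat)%:R.
have F0 l tau : 0 <= F l tau by rewrite /F addr_ge0// mulr_ge0.
apply: (@le_trans _ _ (\sum_(sigma : {ffun 'I_k -> {ffun 'I_n -> bool}})
    2 ^- k * \prod_(l < k) F l (sigma l))).
  apply: ler_sum => sigma _.
  have FE l : F l (sigma l) =
      4 ^+ (d < block_mean k l.+1 (fun i => sgn (flip k0 sigma i) * y i))%R.
    rewrite /F (_ : block_mean _ _ _ =
      block_mean k l.+1 (fun i => sgn (flip k0 sigma i) * y i)).
      by case: (_ < _); rewrite /= ?mulr0 ?addr0// mulr1 expr1; ring.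
    rewrite !block_meanE; congr (_ / _); apply: eq_bigr => i.
    by rewrite (block_ofE k0) => /eqP il; rewrite /flip il.
  under eq_bigr do rewrite FE.
  rewrite prodrXr -/(bad_blocks k d _); set m := bad_blocks _ _ _.
  case: leqP => km /=; last by rewrite mulr_ge0 ?invr_ge0 ?exprn_ge0.
  rewrite mulrC ler_pdivlMr ?exprn_gt0// mul1r.
  have -> : 4 = 2 ^+ 2 :> R by rewrite -natrX.
  by rewrite -exprM ler_eXn2l ?ltr1n.
rewrite -mulr_sumr -mulrA ler_wpM2l ?invr_ge0 ?exprn_ge0//.
(* Summing a product over blocks over all families of sign vectors gives the product of the
   blockwise sums. *)
rewrite -(bigA_distr_bigA F).
rewrite [X in _ <= _ * X](partition_big (block_of k0) predT)//.
have -> : (2 ^+ n) ^+ k = \prod_(l < k) 2 ^+ n :> R by rewrite prodr_const card_ord.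
rewrite -big_split/=; apply: ler_prod => l _.
rewrite sumr_ge0//=.
rewrite big_split/= sumr_const card_signs natrX -mulr_sumr.
apply: (@le_trans _ _ (2 ^+ n * (1 + \sum_(i < n | in_block k l.+1 i)
    3 * truncsq ((N l.+1)%:R * d) (y i)))).
  rewrite mulrDr mulr1 lerD2l -mulr_sumr mulrCA ler_wpM2l//.
  under eq_bigr do rewrite mean_gt//.
  by apply: sgn_tail; rewrite mulr_ge0.
rewrite ler_wpM2l ?exprn_ge0//.
apply: le_trans (prod1D_ge _ _) _.
  by move=> i; rewrite mulr_ge0// truncsq_ge0.
rewrite le_eqVlt; apply/orP; left; apply/eqP.
by apply: eq_big => i; rewrite (block_ofE k0)// => /eqP <-.
Qed.

(** The inverse of [1 - 1 / 16 <= expR (- 16^-1)]. Sixteenths are fine enough for the numerical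
    bounds below, which use its powers 10 and 8. *)
Lemma expR_inv16_le : expR (16^-1) <= 16 / 15 :> R.
Proof.
have := expR_ge1Dx (- 16^-1 : R); rewrite expRN => h.
rewrite -[leLHS]invrK -[leRHS]invrK lef_pV2 ?posrE ?invr_gt0 ?expR_gt0//; lra.
Qed.

Lemma expR_div16_le m : expR (m%:R * 16^-1) <= (16 / 15) ^+ m :> R.
Proof. by rewrite expRM_natl lerXn2r ?nnegrE ?expR_ge0// expR_inv16_le. Qed.

(** Amounts to [expR (5 / 8) <= 2]; its [k]-th power turns [2 ^- k * expR (k / 2)] into
    [expR (- (k / 8))]. *)
Lemma expR_half : 2^-1 * expR (2^-1) <= expR (- 8^-1) :> R.
Proof.
rewrite ler_pdivrMl// expRN -ler_pdivrMr ?invr_gt0 ?expR_gt0// invrK -expRD.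
rewrite (_ : 2^-1 + 8^-1 = 10%:R * 16^-1); last by field.
rewrite (le_trans (expR_div16_le 10))//.
by rewrite !exprS expr0; lra.
Qed.

(* The optimal Chernoff parameter: with [x ^+ 4 = 3] the mean of the weight,
   [(x + x ^- 3) / 2 = 2 x / 3], has fourth power [16 / 27 <= expR (- 2^-1)]. *)
Definition sgn_weight (b : bool) : R := expR (ln 3 / 4 * (2 * sgn b - 1)).

Lemma sum_sgn_weight : \sum_(b : bool) sgn_weight b <= 2 * expR (- 8^-1).
Proof.
rewrite big_bool /= /sgn_weight /sgn expr0 expr1.
set x := expR (ln 3 / 4 * (2 * 1 - 1)).
have x0 : 0 < x by exact: expR_gt0.
have x4 : x ^+ 4 = 3.
  rewrite /x -expRM_natl (_ : _ * _ = ln 3); last by field.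
  by rewrite lnK// posrE.
have -> : expR (ln 3 / 4 * (2 * -1 - 1)) = x / 3.
  rewrite [RHS](_ : _ = x / expR (ln 3)); last by rewrite lnK// posrE.
  rewrite -expRN -expRD; congr expR.
  by field.
rewrite (_ : x / 3 + x = 2 * (2 * x / 3)); last by field.
rewrite ler_pM2l// -(@ler_pXn2r _ 4)// ?nnegrE ?expR_ge0//; last first.
  by rewrite divr_ge0// mulr_ge0// ltW.
rewrite -expRM_natl (_ : (2 * x / 3) ^+ 4 = 16 / 81 * x ^+ 4); last by field.
rewrite x4 mulrN expRN -[leLHS]invrK lef_pV2 ?posrE ?expR_gt0//.
rewrite (_ : 4 * 8^-1 = 8%:R * 16^-1); last by field.
by apply: (le_trans (expR_div16_le 8)); rewrite !exprS expr0; lra.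
Qed.

(** On the event, the sum of [2 * sgn (s i) - 1] over the block is positive, so the product of the
    weights is at least 1. Indices outside the block get weight 1, and the sum over [s] factors by
    coordinates. *)
Lemma sgn_mean_tail n k l : (0 < block_card n k l)%N ->
  \sum_(s : {ffun 'I_n -> bool})
    ((2^-1 < block_mean k l (fun i => sgn (s i) : R))%R : nat)%:R <=
  2 ^+ n * expR (- ((block_card n k l)%:R / 8)) :> R.
Proof.
move=> c0; pose g (i : 'I_n) b := if in_block k l i then sgn_weight b else 1.
have g0 i b : 0 <= g i b by rewrite /g; case: ifP => // _; exact: expR_ge0.
apply: (@le_trans _ _ (\sum_(s : {ffun 'I_n -> bool}) \prod_(i < n) g i (s i))).
  apply: ler_sum => s _; case: ltP => [|_]; last exact: prodr_ge0.
  rewrite mean_gt// /g -big_mkcond/= -expR_sum => h.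
  rewrite -[leLHS]expR0 ler_expR -mulr_sumr mulr_ge0//.
    by rewrite divr_ge0// ln_ge0// ler1n.
  rewrite sumrB -mulr_sumr sumr_const -/(block_card n k l).
  by rewrite -[1 *+ _]/(_%:R); lra.
rewrite -(bigA_distr_bigA g).
apply: (@le_trans _ _ (\prod_(i < n) (2 *
    if in_block k l i then expR (- 8^-1) else 1))).
  apply: ler_prod => i _; rewrite sumr_ge0//= /g; case: ifP => _.
    exact: sum_sgn_weight.
  by rewrite big_bool/= mulr1.
rewrite big_split/= prodr_const card_ord ler_wpM2l ?exprn_ge0//.
by rewrite -big_mkcond/= prodr_const -/(block_card n k l) -expRM_natl mulrN.
Qed.

End signs.

(** * The tail of the number of large block means *)

Lemma measurable_bad (R : realType) d (T : measurableType d) n k (x : 'I_n -> T -> R) c :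
  (forall i, measurable_fun setT (x i)) ->
  measurable [set w | (k <= 2 * bad_blocks k c (fun i => x i w))%N].
Proof.
move=> mx; apply: measurable_bool_set; apply: measurable_fun_leq => //.
apply: (@measurableT_comp _ _ _ _ _ _ (muln 2)) => //.
apply: measurable_bool_sum => l; apply: measurable_fun_ltr => //.
exact: measurable_block_mean.
Qed.

Lemma measurable_truncsq (R : realType) (t : R) : measurable_fun setT (truncsq t).
Proof.
apply: measurable_fun_ifT.
- by apply: measurable_fun_ler => //; exact: measurable_funX.
- by apply: measurable_funM => //; exact: measurable_funX.
- exact: measurable_cst.
Qed.

Section bad_blocks_tail.
Context {R : realType} d (T : measurableType d) (P : probability T R).

Lemma integral_indic_sum (I : finType) (c : I -> R) (A : I -> set T) :
  (forall i, 0 <= c i) -> (forall i, measurable (A i)) ->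
  (\int[P]_w (\sum_i c i * \1_(A i) w)%:E = \sum_i (c i)%:E * P (A i))%E.
Proof.
move=> c0 mA; under eq_integral do rewrite -sumEFin.
rewrite ge0_integral_sum//=; last 2 first.
- by move=> i; apply/measurable_EFinP; apply: measurable_funM => //.
- by move=> i w _; rewrite lee_fin mulr_ge0.
apply: eq_bigr => i _; under eq_integral do rewrite EFinM.
rewrite ge0_integralZl//=; last 2 first.
- exact/measurable_EFinP.
- by rewrite lee_fin.
by rewrite integral_indic// setIT.
Qed.

Lemma probability_fin (A : set T) : measurable A -> (fine (P A))%:E = P A.
Proof. by move=> mA; rewrite fineK// fin_num_measure. Qed.

Variables (n : nat) (Y : 'I_n -> T -> R).
Hypothesis mY : forall i, measurable_fun setT (Y i).
Hypothesis Y_indep : forall B : 'I_n -> set R, (forall i, measurable (B i)) ->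
  (P (\bigcap_i (Y i @^-1` B i)) = \prod_(i < n) P (Y i @^-1` B i))%E.

Lemma measurable_pre i (B : set R) : measurable B -> measurable (Y i @^-1` B).
Proof. by move=> mB; rewrite -[X in measurable X]setTI; exact: mY. Qed.

(** Expand the product over all choices of one [j] per coordinate: each term is the indicator of an
    intersection to which independence applies. *)
Lemma integral_prod_indic (J : finType) (c : J -> R) (A : 'I_n -> J -> set R) :
  (forall j, 0 <= c j) -> (forall i j, measurable (A i j)) ->
  (\int[P]_w (\prod_(i < n) \sum_j c j * \1_(A i j) (Y i w))%:E =
   \prod_(i < n) \int[P]_w (\sum_j c j * \1_(A i j) (Y i w))%:E)%E.
Proof.
move=> c0 mA.
have preE i j w : \1_(A i j) (Y i w) = \1_(Y i @^-1` A i j) w :> R by [].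
have mP i j : measurable (Y i @^-1` A i j) by exact: measurable_pre.
transitivity (\prod_(i < n) \sum_j c j * fine (P (Y i @^-1` A i j)))%:E; last first.
  rewrite -prodEFin; apply: eq_bigr => i _.
  under eq_integral do under eq_bigr do rewrite preE.
  rewrite integral_indic_sum// -sumEFin; apply: eq_bigr => j _.
  by rewrite EFinM probability_fin.
rewrite [in RHS]bigA_distr_bigA -sumEFin.
transitivity (\int[P]_w (\sum_(g : {ffun 'I_n -> J})
    (\prod_(i < n) c (g i)) * \1_(\bigcap_i (Y i @^-1` A i (g i))) w)%:E)%E.
  apply: eq_integral => w _; congr EFin.
  rewrite bigA_distr_bigA; apply: eq_bigr => g _; rewrite big_split/=; congr (_ * _).
  rewrite indicE; case: (asboolP ((\bigcap_i (Y i @^-1` A i (g i))) w)) => h.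
    rewrite big1 ?mem_set// => i _; rewrite indicE mem_set//.
    exact: (h i).
  rewrite memNset//; apply/eqP; rewrite prodf_seq_eq0.
  move/existsNP: h => [i /not_implyP[_ hi]].
  by apply/hasP; exists i; rewrite ?mem_index_enum//= indicE memNset.
rewrite integral_indic_sum; last 2 first.
- by move=> g; exact: prodr_ge0.
- move=> g; apply: fin_bigcap_measurable => [|i _]; first exact: finite_finset.
  exact: mP.
apply: eq_bigr => g _; rewrite Y_indep// big_split/= EFinM -prodEFin.
by congr (_ * _)%E; rewrite -prodEFin; apply: eq_bigr => i _; rewrite probability_fin.
Qed.

Hypothesis Y_sym : forall i (B : set R), measurable B ->
  P (Y i @^-1` B) = P ((fun w => - Y i w) @^-1` B).

(** Negating coordinates preserves the marginals, hence the probabilities of boxes, and [law_unique]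
    extends this to [G]. It is applied with [A] the whole space and with [A] an event fixing the
    signs [alpha]. *)
Lemma flip_law (A : set T) (c : R) (s : 'I_n -> bool) (G : set (g_sigma_algebraType (@boxes R n))) :
  measurable A ->
  (forall B : 'I_n -> set R, (forall i, measurable (B i)) ->
    P (A `&` \bigcap_i (Y i @^-1` B i)) =
    (c%:E * \prod_(i < n) P (Y i @^-1` B i))%E) ->
  measurable G ->
  P (A `&` [set w | G (fun i => sgn (s i) * Y i w)]) =
  (c%:E * P [set w | G (fun i => Y i w)])%E.
Proof.
move=> mA AY mG; apply: (law_unique (Z := fun i w => sgn (s i) * Y i w)) => //.
  by move=> i; exact: measurable_funM.
move=> B mB; rewrite Y_indep//.
have mB' i : measurable ((fun x : R => sgn (s i) * x) @^-1` B i).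
  rewrite -[X in measurable X]setTI.
  exact: (@mulrl_measurable R setT (sgn (s i))).
rewrite (AY (fun i => (fun x : R => sgn (s i) * x) @^-1` B i))//.
congr (_ * _)%E; apply: eq_bigr => i _; rewrite /sgn; case: (s i).
  rewrite [RHS]Y_sym//; congr (P _).
  by apply/seteqP; split => w /=; rewrite expr1 mulN1r.
by congr (P _); apply/seteqP; split => w /=; rewrite expr0 mul1r.
Qed.

Lemma bad_blocks_tail k (k0 : (0 < k)%N) (c : R) : (k <= n)%N -> 0 <= c ->
  (forall i (l : 'I_k),
    (\int[P]_w (truncsq ((block_card n k l.+1)%:R * c) (Y i w))%:E <=
     ((12 * (block_card n k l.+1)%:R)^-1)%:E)%E) ->
  (P [set w | (k <= 2 * bad_blocks k c (fun i => Y i w))%N] <=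
   (expR (- (k%:R / 8)))%:E)%E.
Proof.
move=> kn c0 trunc_le.
have n0 : (0 < n)%N by exact: leq_trans kn.
pose N (i : 'I_n) : R := (block_card n k (block_of k0 i).+1)%:R.
have N0 i : 0 < N i.
  rewrite ltr0n; apply: leq_trans (block_card_ge n _).
  by rewrite divn_gt0.
have Nn i : N i <= n%:R.
  by rewrite ler_nat -[leqRHS]card_ord max_card.
(* Fine enough for the rounding error [3 / D] to be at most [3 / (12 * N i)], which is also the
   bound from [trunc_le]; together they give [2^-1 / N i]. *)
pose D := (12 * n)%N.
have D0 : (0 < D)%N by rewrite muln_gt0.
(* Index 0 carries the constant 1 and the others the grid indicators, so that [1 + 3 * gridup] has
   the form that [integral_prod_indic] requires. *)
pose cf (j : 'I_D.+1) : R := if j == ord0 then 1 else 3 / D%:R.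
pose A (i : 'I_n) (j : 'I_D.+1) : set R :=
  if j == ord0 then setT else [set y | j.-1%:R / D%:R < truncsq (N i * c) y].
have mA i j : measurable (A i j).
  rewrite /A; case: ifP => // _.
  by apply: measurable_lt_set => //; exact: measurable_truncsq.
have sumE i y : \sum_j cf j * \1_(A i j) y = 1 + 3 * gridup D (truncsq (N i * c) y).
  rewrite big_ord_recl /cf /A eqxx indicE mem_set// mulr1; congr (_ + _).
  rewrite /gridup mulrA mulr_sumr; apply: eq_bigr => m _.
  rewrite -[lift ord0 m == ord0]/false/= indicE; congr (_ * _).
  by congr (nat_of_bool _)%:R; apply/idP/idP => [/set_mem|h]; [|exact/mem_set].
have cf0 j : 0 <= cf j by rewrite /cf; case: ifP => // _; rewrite divr_ge0.
have tr01 i y : 0 <= truncsq (N i * c) y <= 1 by rewrite truncsq_ge0 truncsq_le1.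
have mtrE i : measurable_fun setT (fun w => (truncsq (N i * c) (Y i w))%:E).
  apply/measurable_EFinP; apply: measurableT_comp (mY i).
  exact: measurable_truncsq.
have sum_ge0 i w : 0 <= \sum_j cf j * \1_(A i j) (Y i w).
  by apply: sumr_ge0 => j _; rewrite mulr_ge0.
have msum i : measurable_fun setT (fun w => \sum_j cf j * \1_(A i j) (Y i w)).
  apply: measurable_sum => j; apply: measurable_funM => //.
  by apply: measurableT_comp => //; exact: measurable_indic.
have gridup_mean i : (\int[P]_w (\sum_j cf j * \1_(A i j) (Y i w))%:E <=
    (expR (2^-1 / N i))%:E)%E.
  have mtr3 : measurable_fun setT
      (fun w => (3%:E * (truncsq (N i * c) (Y i w))%:E)%E).
    exact: measurable_funeM.
  have tr0 w : (0 <= (truncsq (N i * c) (Y i w))%:E)%E.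
    by rewrite lee_fin; exact: truncsq_ge0.
  have cst0 : (0 <= (1 + 3 / D%:R : R)%:E)%E by rewrite lee_fin addr_ge0.
  apply: (@le_trans _ _ (\int[P]_w ((1 + 3 / D%:R)%:E +
      3%:E * (truncsq (N i * c) (Y i w))%:E))%E).
    apply: ge0_le_integral => //.
    - by move=> w _; rewrite lee_fin.
    - by apply/measurable_EFinP.
    - by apply: emeasurable_funD.
    - move=> w _; rewrite -EFinM -EFinD lee_fin sumE.
      by have /andP[_] := gridup_bounds D0 (tr01 i (Y i w)); lra.
  rewrite ge0_integralD//=; last by move=> w _; rewrite mule_ge0.
  rewrite integral_cst//= probability_setT mule1 ge0_integralZl//=.
  apply: (@le_trans _ _ ((1 + 3 / D%:R)%:E + 3%:E * ((12 * N i)^-1)%:E)%E).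
    by rewrite leeD2l// lee_pmul2l//; exact: trunc_le.
  rewrite -EFinM -EFinD lee_fin.
  apply: le_trans (expR_ge1Dx _); rewrite -addrA lerD2l /D natrM.
  have -> : 2^-1 / N i = 3 / (12 * N i) + 3 / (12 * N i).
    by field; exact: (lt0r_neq0 (N0 i)).
  rewrite lerD2r ler_wpM2l// lef_pV2 ?posrE ?mulr_gt0 ?N0 ?ltr0n//.
  by rewrite ler_pM2l.
pose S := {ffun 'I_k -> {ffun 'I_n -> bool}}.
pose G := [set y : g_sigma_algebraType (@boxes R n) | (k <= 2 * bad_blocks k c y)%N].
have mG : measurable G.
  exact: (@measurable_bad _ _ _ n k
    (fun i (y : g_sigma_algebraType (@boxes R n)) => y i) c (@measurable_coord R n)).
pose Gf (sigma : S) := [set w | G (fun i => sgn (flip k0 sigma i) * Y i w)].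
have PGf sigma : P (Gf sigma) = P [set w | G (fun i => Y i w)].
  rewrite -[Gf sigma]setTI (flip_law (c := 1) _ _ _ mG) ?mul1e//.
  by move=> B mB; rewrite setTI mul1e Y_indep.
have mGf sigma : measurable (Gf sigma).
  apply: (@measurable_bad _ _ _ n k (fun i w => sgn (flip k0 sigma i) * Y i w)) => j.
  exact: measurable_funM.
have cardS : #|{: S}| = ((2 ^ n) ^ k)%N.
  by rewrite card_ffun card_signs card_ord.
(* The events [Gf sigma] all have the same probability, so it equals their average over [sigma]. *)
have avg : (((2 ^+ n) ^+ k)%:E * P [set w | G (fun i => Y i w)] =
    \int[P]_w (\sum_(sigma : S) 1 * \1_(Gf sigma) w)%:E)%E.
  rewrite integral_indic_sum//; under [RHS]eq_bigr do rewrite mul1e PGf.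
  by rewrite sumr_const cardS -[RHS]mule_natl !natrX.
have main : (((2 ^+ n) ^+ k)%:E * P [set w | G (fun i => Y i w)] <=
    (2 ^- k * (2 ^+ n) ^+ k * expR (k%:R / 2))%:E)%E.
  rewrite avg; apply: (@le_trans _ _ (\int[P]_w ((2 ^- k * (2 ^+ n) ^+ k)%:E *
      (\prod_(i < n) \sum_j cf j * \1_(A i j) (Y i w))%:E))%E).
    apply: ge0_le_integral => //.
    - by move=> w _; rewrite lee_fin sumr_ge0// => sigma _; rewrite mul1r.
    - apply/measurable_EFinP; apply: measurable_sum => sigma.
      by apply: measurable_funM => //; exact: measurable_indic.
    - apply: measurable_funeM; apply/measurable_EFinP.
        by apply: measurable_prod => j _; exact: msum.
    move=> w _; rewrite -EFinM lee_fin.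
    rewrite (eq_bigr (fun sigma : S => ((k <= 2 * bad_blocks k c
        (fun i => (sgn (flip k0 sigma i) * Y i w)%R))%N : nat)%:R)); last first.
      move=> sigma _; rewrite mul1r indicE.
      by congr (nat_of_bool _)%:R; apply/idP/idP => [/set_mem|h]; [|exact/mem_set].
    apply: le_trans (sum_bad_flip k0 (Y^~ w) kn c0) _.
    rewrite ler_wpM2l ?mulr_ge0 ?invr_ge0 ?exprn_ge0//.
    apply: ler_prod => j _; rewrite addr_ge0 ?mulr_ge0 ?truncsq_ge0//= sumE.
    by have /andP[] := gridup_bounds D0 (tr01 j (Y j w)); rewrite /N; lra.
  rewrite ge0_integralZl//=; last 2 first.
  - by apply/measurable_EFinP; apply: measurable_prod => j _; exact: msum.
  - by move=> w _; rewrite lee_fin prodr_ge0.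
  rewrite integral_prod_indic// [leRHS]EFinM lee_pmul2l ?lte_fin ?mulr_gt0 ?invr_gt0 ?exprn_gt0//.
  apply: (@le_trans _ _ (\prod_(i < n) (expR (2^-1 / N i))%:E)%E).
    suff /andP[] : (0 <= \prod_(i < n) \int[P]_w (\sum_j cf j * \1_(A i j) (Y i w))%:E
        <= \prod_(i < n) (expR (2^-1 / N i))%:E)%E by [].
    elim/big_rec2 : _ => [|i y1 y2 _ /andP[y10 y12]]; first by rewrite lexx andbT.
    have int0 : (0 <= \int[P]_w (\sum_j cf j * \1_(A i j) (Y i w))%:E)%E.
      by apply: integral_ge0 => w _; rewrite lee_fin.
    by rewrite mule_ge0//= lee_pmul.
  rewrite prodEFin lee_fin -expR_sum ler_expR.
  (* Each block contributes its size times [2^-1] over its size, so the exponent is [k / 2]. *)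
  rewrite (partition_big (block_of k0) predT)//=.
  rewrite (eq_bigr (fun=> 2^-1)); first by rewrite sumr_const card_ord -[leLHS]mulr_natl.
  move=> l _; rewrite (eq_bigr (fun=> 2^-1 / (block_card n k l.+1)%:R)); last first.
    by move=> i /eqP <-.
  have cl0 : (block_card n k l.+1)%:R != 0 :> R.
    rewrite pnatr_eq0 -lt0n; apply: leq_trans (block_card_ge n _).
    by rewrite divn_gt0.
  rewrite sumr_const -[LHS]mulr_natl (_ : #|_| = block_card n k l.+1).
    by rewrite mulrCA divff ?mulr1.
  by apply: eq_card => i; rewrite !inE (block_ofE k0).
have p2 : 0 < ((2 ^+ n) ^+ k : R) by rewrite !exprn_gt0.
rewrite -(@lee_pmul2l _ ((2 ^+ n) ^+ k)%:E)//.
apply: le_trans main _; rewrite -EFinM lee_fin [2 ^- k * _]mulrC -mulrA ler_pM2l//.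
have -> : expR (- (k%:R / 8)) = expR (- 8^-1) ^+ k :> R.
  by rewrite -expRM_natl mulrN.
rewrite expRM_natl -exprVn -exprMn lerXn2r ?nnegrE ?mulr_ge0 ?invr_ge0 ?expR_ge0//.
exact: expR_half.
Qed.

End bad_blocks_tail.

(** * Moments and the deterministic inclusion *)

Lemma block_mean_cst (R : realType) n k l (c : R) : (0 < block_card n k l)%N ->
  @block_mean R n k l (fun=> c) = c.
Proof.
move=> c0; rewrite block_meanE sumr_const -/(block_card n k l) -[_ *+ _]mulr_natr.
by rewrite mulfK// pnatr_eq0 -lt0n.
Qed.

Lemma block_meanD (R : realType) n k l (x y : 'I_n -> R) :
  block_mean k l (fun i => x i + y i) = block_mean k l x + block_mean k l y.
Proof. by rewrite !block_meanE big_split mulrDl. Qed.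

Lemma block_meanZ (R : realType) n k l (x : 'I_n -> R) c :
  block_mean k l (fun i => c * x i) = c * block_mean k l x.
Proof. by rewrite !block_meanE -mulr_sumr mulrA. Qed.

Lemma Usup_gt_bad (R : realType) n k (x s : 'I_n -> R) p (mu c : R) :
  (0 < k)%N -> (k <= n)%N -> 0 <= c ->
  (forall l : 'I_k, block_mean k l.+1 s <= 2^-1) ->
  ((4 * c)%:E < Usup k x s p - mu%:E)%E ->
  (k <= 2 * bad_blocks k c (fun i => (x i - mu)%R))%N \/
  (k <= 2 * bad_blocks k c (fun i => (- (s i * (x i - mu)))%R))%N.
Proof.
move=> k0 kn c0 hs /Usup_gtP[t ct].
have card0 (l : 'I_k) : (0 < block_card n k l.+1)%N.
  by apply: leq_trans (block_card_ge n l); rewrite divn_gt0.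
rewrite /precpi negb_or -leNgt /S0 /S1 /D0 lerD2r => /andP[le_mom _].
have [momx|momx] := ltP (mu + c) (mom k x).
  left; apply: mom_gt => //; rewrite -(ltrD2l mu); apply: (lt_le_trans momx).
  rewrite addrC; apply: mom_leD => // l.
  by rewrite -[X in _ + X](@block_mean_cst R n k l.+1)// -block_meanD le_eqVlt
     (_ : (fun i => _) = x) ?eqxx//; apply/funext => i; rewrite subrK.
(* Now [mom k (D1 x s t) <= mu + c]; subtracting [mu + (t - mu) / 2], where [t - mu > 4 * c], leaves
   less than [- c]. This fixes the factor 4. *)
right; apply: mom_lt => //.
have : mom k (fun i => s i * (x i - mu)) <=
    mom k (D1 x s t) + - (mu + (t - mu) / 2).
  apply: mom_leD => // l.
  have -> : D1 x s t = fun i => s i * (x i - mu) + (mu + (t - mu) * (1 + (- 1) * s i)).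
    by apply/funext => i; rewrite /D1; ring.
  rewrite block_meanD block_meanD block_mean_cst// block_meanZ block_meanD.
  rewrite block_mean_cst// block_meanZ -addrA lerDl.
  have tmu : 0 <= t - mu by lra.
  have := ler_wpM2l tmu (hs l); lra.
by lra.
Qed.

Section symmetric.
Context {R : realType} d (T : measurableType d) (P : probability T R).

Lemma eq_law_expectation (Y Z : T -> R) :
  measurable_fun setT Y -> measurable_fun setT Z ->
  P.-integrable setT (EFin \o Y) -> P.-integrable setT (EFin \o Z) ->
  (forall B : set R, measurable B -> P (Y @^-1` B) = P (Z @^-1` B)) ->
  ('E_P[Y] = 'E_P[Z])%E.
Proof.
move=> mY mZ iY iZ YZ.
pose Y' : {RV P >-> R} := HB.pack Y (isMeasurableFun.Build _ _ _ _ Y mY).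
pose Z' : {RV P >-> R} := HB.pack Z (isMeasurableFun.Build _ _ _ _ Z mZ).
rewrite !unlock.
have intE (W : {RV P >-> R}) : P.-integrable setT (EFin \o W) ->
    (\int[P]_w (W w)%:E = \int[distribution P W]_y y%:E)%E.
  by move=> iW; rewrite (integral_distribution (f := EFin)).
rewrite (intE Y' iY) (intE Z' iZ); apply: eq_measure_integral => B mB _.
exact: YZ.
Qed.

(** [X] and [2 * mu - X] have equal means, finite by integrability, so the equation can be solved
    for the mean. *)
Lemma symmetric_mean (X : T -> R) (mu : R) : measurable_fun setT X ->
  P.-integrable setT (EFin \o X) ->
  (forall B : set R, measurable B ->
     P (X @^-1` B) = P ((fun w => 2 * mu - X w) @^-1` B)) ->
  fine 'E_P[X] = mu.
Proof.
move=> mX iX symX.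
have icst : P.-integrable setT (EFin \o cst (2 * mu) : T -> \bar R).
  exact: finite_measure_integrable_cst.
have i2 : P.-integrable setT (EFin \o (fun w => 2 * mu - X w)).
  rewrite (_ : _ \o _ = ((EFin \o cst (2 * mu)%R) \- (EFin \o X))%E).
    exact: integrableB.
  by apply/funext => w.
have EX : ('E_P[X] = (2 * mu)%:E - 'E_P[X])%E.
  rewrite [LHS](eq_law_expectation mX _ iX i2 symX); last exact: measurable_funB.
  rewrite !unlock.
  transitivity (\int[P]_w ((EFin \o cst (2 * mu)%R) \- (EFin \o X)) w)%E.
    exact: eq_integral.
  rewrite integralB//.
  have -> : (\int[P]_w (EFin \o cst (2 * mu)%R) w = (2 * mu)%:E)%E.
    by rewrite -[RHS]mule1 -(probability_setT P) -integral_cst.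
  by [].
have Ef : ('E_P[X])%E \is a fin_num by rewrite unlock; exact: integrable_fin_num.
move: EX; rewrite -{1 2}(fineK Ef) -EFinB => -[]; lra.
Qed.

End symmetric.

(** With [z] the ratio of the absolute value of [y] to [t], the claim is that the minimum of 1 and
    [z ^+ 2] is at most [z] to the power [p]: by [p <= 2] if [z <= 1], by [0 <= p] otherwise. *)
Lemma truncsq_le_powR (R : realType) (t y p : R) : 0 < t -> 0 <= p -> p <= 2 ->
  truncsq t y <= (t `^ p)^-1 * `|y| `^ p.
Proof.
move=> t0 p0 p2; have [z0 yz] : 0 <= `|y| / t /\ `|y| = `|y| / t * t.
  by rewrite divr_ge0 ?(ltW t0)// divfK// gt_eqF.
have -> : truncsq t y = if `|y| / t <= 1 then (`|y| / t) ^+ 2 else 1.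
  rewrite /truncsq -(real_normK (num_real y)) expr_div_n; congr (if _ then _ else _).
  by rewrite ler_pdivrMr// mul1r ler_pXn2r// ?nnegrE// ltW.
rewrite [in leRHS]yz powRM ?(ltW t0)// mulrCA mulVf ?mulr1; last first.
  by rewrite gt_eqF// powR_gt0.
move: (`|y| / t) z0 => z z0; case: ifPn => z1.
  move: z0; rewrite le_eqVlt => /orP[/eqP<-|z0].
    by rewrite expr0n powR_ge0.
  by rewrite -powR_mulrn ?(ltW z0)// ger_powR// z0.
by rewrite -(powRr0 z) ler_powR// ltW// ltNge.
Qed.

Lemma truncsq_mean_le (R : realType) d (T : measurableType d)
    (P : probability T R) (Y : T -> R) (p M t N : R) :
  measurable_fun setT Y -> 0 < p -> p <= 2 ->
  (\int[P]_w (`|Y w| `^ p)%:E = M%:E)%E ->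
  0 <= t -> 0 < N -> 12 * N * M <= t `^ p ->
  (\int[P]_w (truncsq t (Y w))%:E <= ((12 * N)^-1)%:E)%E.
Proof.
move=> mY p0 p2 EM t0 N0 tM.
have mp : measurable_fun setT (fun w => (`|Y w| `^ p)%:E).
  apply/measurable_EFinP; apply: (measurableT_comp (measurable_powR p)).
  exact: measurableT_comp mY.
have mt : measurable_fun setT (fun w => (truncsq t (Y w))%:E).
  by apply/measurable_EFinP; apply: measurableT_comp mY; exact: measurable_truncsq.
have M0 : 0 <= M.
  by rewrite -lee_fin -EM; apply: integral_ge0 => w _; rewrite lee_fin powR_ge0.
move: t0; rewrite le_eqVlt => /orP[/eqP t0|t0].
  (* A zero threshold forces [M = 0], so [Y] vanishes almost everywhere, and [truncsq 0 0 = 0]. *)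
  have M00 : M = 0.
    move: tM; rewrite -t0 powR0 ?gt_eqF// pmulr_rle0 ?mulr_gt0// => M1.
    by apply/eqP; rewrite eq_le M1.
  suff -> : (\int[P]_w (truncsq t (Y w))%:E = 0)%E.
    by rewrite lee_fin invr_ge0 mulr_ge0// ltW.
  have : (\int[P]_w `|(`|Y w| `^ p)%:E| = 0)%E.
    rewrite -[RHS]/(0%:E) -M00 -EM; apply: eq_integral => w _.
    by rewrite gee0_abs// lee_fin powR_ge0.
  move=> /(ae_eq_integral_abs _ measurableT mp) ae0.
  rewrite -(integral0 P setT); apply: ge0_ae_eq_integral => //.
    by move=> w _; rewrite lee_fin truncsq_ge0.
  apply: filterS ae0 => w /(_ I) [] /powR_eq0_eq0 /normr0_eq0 Yw0 _.
  by rewrite /truncsq Yw0 -t0 expr0n/= lexx mul0r.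
apply: (@le_trans _ _ (\int[P]_w (((t `^ p)^-1)%:E * (`|Y w| `^ p)%:E))%E).
  apply: ge0_le_integral => //.
  - by move=> w _; rewrite lee_fin truncsq_ge0.
  - exact: measurable_funeM.
  - by move=> w _; rewrite -EFinM lee_fin truncsq_le_powR// ltW.
rewrite ge0_integralZl//; last by rewrite lee_fin invr_ge0 powR_ge0.
rewrite EM -EFinM lee_fin ler_pdivrMl ?powR_gt0// ler_pdivlMr ?mulr_gt0//.
by rewrite mulrC.
Qed.

(** The right side is [12 * N * M] times the power [a] of [N / m], a ratio at least 1. It provides
    the threshold condition of [truncsq_mean_le] for a block of size [N]. *)
Lemma mom_scale_bound (R : realType) (a M : R) (m N : nat) :
  0 < a -> 0 <= M -> (0 < m)%N -> (m <= N)%N ->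
  12 * N%:R * M <=
  (N%:R * ((12 * M) `^ (1 / (1 + a)) * (1 / m%:R) `^ (a / (1 + a)))) `^ (1 + a).
Proof.
move=> a0 M0 m0 mN; have p0 : 1 + a != 0 by rewrite gt_eqF// addr_gt0.
have N0 : 0 < N%:R :> R by rewrite ltr0n (leq_trans m0).
rewrite powRM ?mulr_ge0 ?powR_ge0// powRM ?powR_ge0// -!powRrM !divfK//.
rewrite powRr1 ?mulr_ge0// powRD ?(negbTE p0)// powRr1 ?(ltW N0)//.
have : 1 <= (N%:R * (1 / m%:R)) `^ a :> R.
  rewrite -[leLHS](powRr0 (N%:R * (1 / m%:R))) ler_powR ?(ltW a0)//.
  by rewrite mulrA mulr1 ler_pdivlMr ?ltr0n// mul1r ler_nat.
rewrite powRM ?(ltW N0) ?divr_ge0// => h.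
rewrite (_ : _ * _ * (_ * _) = 12 * N%:R * M * (N%:R `^ a * (1 / m%:R) `^ a)); last first.
  by ring.
by rewrite ler_peMr// !mulr_ge0.
Qed.

Lemma probability_bigsetU_le (R : realType) d (T : measurableType d)
    (P : probability T R) (I : Type) (s : seq I) (F : I -> set T) :
  (forall i, measurable (F i)) ->
  (P (\big[setU/set0]_(i <- s) F i) <= \sum_(i <- s) P (F i))%E.
Proof.
move=> mF; elim: s => [|i s IH]; first by rewrite !big_nil measure0.
rewrite !big_cons (le_trans (measureU2 _ _ _))//; last by rewrite leeD2l.
by apply: bigsetU_measurable.
Qed.

(** * Conditioning on the sign vector and assembling the bound *)

Unset Implicit Arguments.
Set Strict Implicit.

Theorem theorem6 (R : realType) (d : measure_display) (T : measurableType d)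
  (P : probability T R) (n k : nat) (X alpha : 'I_n -> T -> R)
  (pi : T -> {perm 'I_2}) (mu a M : R) :
  (0 < k)%N -> (k <= n)%N -> 0 < a -> a <= 1 ->
  (* X_1, ..., X_n identically distributed real random variables *)
  (forall i, measurable_fun setT (X i)) ->
  (forall i j (B : set R), measurable B -> P (X i @^-1` B) = P (X j @^-1` B)) ->
  (* the common distribution is symmetric about mu *)
  (forall i (B : set R), measurable B ->
     P (X i @^-1` B) = P ((fun w => 2 * mu - X i w) @^-1` B)) ->
  (* E|X_1 - E X_1|^(1+a) = M < oo *)
  (forall i, P.-integrable setT (EFin \o X i)) ->
  (forall i, ('E_P[(fun w => `|X i w - fine 'E_P[X i]| `^ (1 + a))%R] = M%:E)%E) ->
  (* Rademacher signs *)
  (forall i, measurable_fun setT (alpha i)) ->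
  (forall i, P (alpha i @^-1` [set 1]) = (1 / 2)%:E) ->
  (forall i, P (alpha i @^-1` [set -1]) = (1 / 2)%:E) ->
  (* uniformly random permutation of {0,1} *)
  (forall A : set {perm 'I_2}, measurable (pi @^-1` A)) ->
  (forall s : {perm 'I_2}, P (pi @^-1` [set s]) = (1 / 2)%:E) ->
  (* data, signs and permutation mutually independent *)
  mutually_independent P X alpha pi ->
  let ntilde := (n %/ k)%N in
  (P [set w | (Usup k (fun i => X i w) (fun i => alpha i w) (pi w) - mu%:E >
               (4 * (12 * M) `^ (1 / (1 + a)) * (1 / ntilde%:R) `^ (a / (1 + a)))%:E)%E]
   <= (2 * k%:R * expR (- (ntilde%:R / 8)) + 2 * expR (- (k%:R / 8)))%:E)%E.
Proof.
move=> k0 kn a0 a1 mX _ symX iX momX malpha alpha1 alphaN1 mpi _ indep.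
cbv zeta; set m := (n %/ k)%N.
have n0 : (0 < n)%N by exact: leq_trans kn.
have m0 : (0 < m)%N by rewrite divn_gt0.
pose Y i w := X i w - mu.
have mY i : measurable_fun setT (Y i) by exact: measurable_funB.
pose c := (12 * M) `^ (1 / (1 + a)) * (1 / m%:R) `^ (a / (1 + a)).
have c0 : 0 <= c by rewrite mulr_ge0 ?powR_ge0.
pose As (s : {ffun 'I_n -> bool}) : set T := \bigcap_i (alpha i @^-1` [set sgn (s i)]).
have malpha1 i x : measurable (alpha i @^-1` [set x]).
  by rewrite -[X in measurable X]setTI; exact: malpha.
have mAs s : measurable (As s).
  by apply: fin_bigcap_measurable => [|i _]; [exact: finite_finset|exact: malpha1].
have cT (W : 'I_n -> T -> R) : \bigcap_i (W i @^-1` [set: R]) = [set: T] by exact/seteqP.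
have shift_meas (B : set R) : measurable B -> measurable [set x : R | B (x - mu)].
  move=> mB; rewrite -[X in measurable X]setTI.
  have msub : measurable_fun [set: R] (fun x : R => x - mu) by exact: measurable_funB.
  exact: (msub measurableT _ mB).
have prodT (W : 'I_n -> T -> R) : (\prod_(i < n) P (W i @^-1` [set: R]) = 1)%E.
  by rewrite big1// => i _; rewrite preimage_setT probability_setT.
have Y_indep (B : 'I_n -> set R) : (forall i, measurable (B i)) ->
    (P (\bigcap_i (Y i @^-1` B i)) = \prod_(i < n) P (Y i @^-1` B i))%E.
  move=> mB; have := indep (fun i => [set x | B i (x - mu)]) (fun=> setT) setT
    (fun i => shift_meas _ (mB i)) (fun=> measurableT).
  by rewrite cT preimage_setT !setIT probability_setT big1_eq !mule1.
have As_indep s (B : 'I_n -> set R) : (forall i, measurable (B i)) ->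
    (P (As s `&` \bigcap_i (Y i @^-1` B i)) =
     (2 ^- n)%:E * \prod_(i < n) P (Y i @^-1` B i))%E.
  move=> mB; have := indep (fun i => [set x | B i (x - mu)])
    (fun i => [set sgn (s i)]) setT
    (fun i => shift_meas _ (mB i)) (fun=> measurable_set1 _).
  rewrite preimage_setT setIT probability_setT mule1 setIC => ->.
  rewrite muleC; congr (_ * _)%E.
  rewrite (eq_bigr (fun=> (2^-1)%:E)); first by rewrite prodEFin prodr_const card_ord exprVn.
  by move=> i _; rewrite /sgn; case: (s i); rewrite ?expr1 ?expr0 ?alpha1 ?alphaN1 div1r.
have Y_sym i (B : set R) : measurable B ->
    P (Y i @^-1` B) = P ((fun w => - Y i w) @^-1` B).
  move=> mB; rewrite [LHS](symX i _ (shift_meas _ mB)); congr (P _).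
  by apply/seteqP; split => w /=; rewrite /Y (_ : 2 * mu - X i w - mu = - (X i w - mu))//; ring.
have EX i : fine 'E_P[X i] = mu by exact: (symmetric_mean (mX i) (iX i) (symX i)).
have EY i : (\int[P]_w (`|Y i w| `^ (1 + a))%:E = M%:E)%E.
  by have := momX i; rewrite EX unlock.
have M0 : 0 <= M.
  rewrite -lee_fin -(EY (Ordinal n0)); apply: integral_ge0 => w _.
  by rewrite lee_fin powR_ge0.
pose q := expR (- (k%:R / 8)) : R.
have tailY : (P [set w | (k <= 2 * bad_blocks k c (fun i => Y i w))%N] <= q%:E)%E.
  apply: (bad_blocks_tail mY Y_indep Y_sym k0 kn c0) => i l.
  have mN := block_card_ge n l.
  have N0 : 0 < (block_card n k l.+1)%:R :> R by rewrite ltr0n (leq_trans m0).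
  apply: (truncsq_mean_le (mY i) _ _ (EY i)) => //.
  - by rewrite addr_gt0.
  - by rewrite -[leRHS]/(1 + 1) lerD2l.
  - by rewrite mulr_ge0// ltW.
  - exact: mom_scale_bound.
pose vec := g_sigma_algebraType (@boxes R n).
pose G := [set y : vec | (k <= 2 * bad_blocks k c y)%N].
have mG : measurable G.
  exact: (@measurable_bad _ _ _ n k (fun i (y : vec) => y i) c (@measurable_coord R n)).
have tail_s (s s' : {ffun 'I_n -> bool}) :
    (P (As s `&` [set w | G (fun i => (sgn (s' i) * Y i w)%R)]) <= (2 ^- n * q)%:E)%E.
  rewrite (flip_law mY Y_indep Y_sym s' (mAs s) (As_indep s) mG) EFinM.
  by rewrite lee_pmul2l ?lte_fin ?invr_gt0 ?exprn_gt0.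
have PAs s : P (As s) = (2 ^- n)%:E.
  have := As_indep s (fun=> setT) (fun=> measurableT).
  by rewrite cT setIT prodT mule1.
rewrite -[4 * _ * _]mulrA -/c; set E := [set w | _].
have mE : measurable E by exact: measurable_Usup_gt.
pose mean_gt_half (s : {ffun 'I_n -> bool}) (l : 'I_k) : bool :=
  2^-1 < block_mean k l.+1 (fun i => sgn (s i) : R).
have PEs s : (P (E `&` As s) <=
    (2 ^- n * (\sum_(l < k) (mean_gt_half s l : nat)%:R + 2 * q))%:E)%E.
  have [/existsP[l sl]|sbad] := boolP [exists l, mean_gt_half s l].
    apply: (@le_trans _ _ (P (As s))).
      by apply: le_measure; rewrite ?inE//; exact: measurableI.
    rewrite PAs lee_fin ler_peMr ?invr_ge0 ?exprn_ge0//.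
    rewrite (bigD1 l)//= sl -addrA lerDl addr_ge0//; first exact: sumr_ge0.
    by rewrite mulr_ge0// expR_ge0.
  (* The pattern [s0] leaves [Y] unchanged, while on [As s] the opposite pattern [sN] produces
     [- alpha Y]. *)
  pose s0 := [ffun i : 'I_n => false]; pose sN := [ffun i => ~~ s i].
  have mF s' : measurable (As s `&` [set w | G (fun i => sgn (s' i) * Y i w)]).
    apply: measurableI => //.
    apply: (@measurable_bad _ _ _ n k (fun i w => sgn (s' i) * Y i w)) => i.
    exact: measurable_funM.
  apply: (@le_trans _ _ (P ((As s `&` [set w | G (fun i => sgn (s0 i) * Y i w)]) `|`
      (As s `&` [set w | G (fun i => sgn (sN i) * Y i w)])))).
    apply: le_measure; rewrite ?inE//; [exact: measurableI|exact: measurableU|].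
    move=> w [Ew Aw].
    have alphaE i : alpha i w = sgn (s i) by exact: Aw.
    have hs (l : 'I_k) : block_mean k l.+1 (alpha^~ w) <= 2^-1.
      rewrite leNgt; apply/negP => hl; move/existsPn: sbad => /(_ l)/negP; apply.
      by rewrite /mean_gt_half -(funext alphaE).
    have [h|h] := Usup_gt_bad k0 kn c0 hs Ew; [left|right]; split => //; rewrite /G/=.
      rewrite (_ : (fun i => _) = (fun i => X i w - mu))//.
      by apply/funext => i; rewrite ffunE /sgn expr0 mul1r.
    rewrite (_ : (fun i => _) = (fun i => - (alpha i w * (X i w - mu))))//.
    apply/funext => i; rewrite ffunE alphaE /sgn signrN mulNr.
    by [].
  apply: (le_trans (measureU2 _ (mF _) (mF _))).
  apply: (le_trans (leeD (tail_s s s0) (tail_s s sN))).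
  rewrite -EFinD lee_fin -mulrDr ler_wpM2l ?invr_ge0 ?exprn_ge0//.
  by rewrite (_ : q + q = 2 * q) ?lerDr ?sumr_ge0//; ring.
(* The signs take the values 1 and -1 only almost surely; the events [As s] cover [U], whose
   complement is null. *)
pose U := \bigcap_i (alpha i @^-1` [set x : R | x = 1 \/ x = -1]).
have Uset : [set x : R | x = 1 \/ x = -1] = [set 1] `|` [set -1] by [].
have mpm1 : measurable [set x : R | x = 1 \/ x = -1].
  by rewrite Uset; exact: measurableU.
have mU : measurable U.
  apply: fin_bigcap_measurable => [|i _]; first exact: finite_finset.
  by rewrite -[X in measurable X]setTI; exact: malpha.
have PU : P U = 1%E.
  have := indep (fun=> setT) (fun=> [set x : R | x = 1 \/ x = -1]) setT
    (fun=> measurableT) (fun=> mpm1).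
  rewrite cT preimage_setT setTI setIT probability_setT mule1 big1_eq mul1e => ->.
  rewrite big1// => i _; rewrite Uset preimage_setU.
  have -> : P (alpha i @^-1` [set 1] `|` alpha i @^-1` [set -1]) =
      (P (alpha i @^-1` [set 1%R]) + P (alpha i @^-1` [set (-1)%R]))%E.
    apply: measureU => //; rewrite -subset0 => w [/= -> ]/eqP.
    by rewrite -addr_eq0 -[1 + 1]/(2%:R : R) pnatr_eq0.
  by rewrite alpha1 alphaN1 -EFinD; congr EFin; field.
have UAs w : U w -> exists s, As s w.
  move=> Uw; exists [ffun i => alpha i w == -1] => i _ /=; rewrite ffunE /sgn.
  have [->|->] := Uw i I; last by rewrite eqxx expr1.
  by rewrite (_ : (1 == -1 :> R) = false)// -addr_eq0 -[1 + 1]/(2%:R : R) pnatr_eq0.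
have sub : E `<=` ~` U `|` \big[setU/set0]_(s : {ffun 'I_n -> bool}) (E `&` As s).
  move=> w Ew; have [Uw|Uw] := pselect (U w); last by left.
  right; have [s As_w] := UAs w Uw.
  by rewrite -bigcup_seq; exists s => //=; rewrite mem_index_enum.
apply: (@le_trans _ _ (\sum_(s : {ffun 'I_n -> bool}) P (E `&` As s))%E).
  apply: (@le_trans _ _ (P (~` U `|` \big[setU/set0]_(s : {ffun 'I_n -> bool}) (E `&` As s)))).
    apply: le_measure; rewrite ?inE//; apply: measurableU; first exact: measurableC.
    by apply: bigsetU_measurable => s _; exact: measurableI.
  apply: (le_trans (measureU2 _ _ _)); first exact: measurableC.
    by apply: bigsetU_measurable => s _; exact: measurableI.
  have PUC : (P (~` U) <= 0)%E by rewrite probability_setC// PU subee.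
  rewrite -[leRHS]add0e; apply: leeD; first exact: PUC.
  by apply: probability_bigsetU_le => s; exact: measurableI.
apply: (@le_trans _ _ (\sum_(s : {ffun 'I_n -> bool})
   (2 ^- n * (\sum_(l < k) (mean_gt_half s l : nat)%:R + 2 * q))%:E)%E).
  exact: lee_sum.
rewrite sumEFin lee_fin -mulr_sumr big_split/= sumr_const card_signs.
rewrite exchange_big/= -[2 * q *+ _]mulr_natl natrX mulrDr mulKf ?expf_neq0//.
rewrite lerD2r.
rewrite mulr_sumr (@le_trans _ _ (\sum_(l < k) expR (- (m%:R / 8))))//.
  apply: ler_sum => l _; rewrite ler_pdivrMl ?exprn_gt0//.
  have mN := block_card_ge n l.
  apply: (le_trans (sgn_mean_tail (R := R) (leq_trans m0 mN))).
  by rewrite ler_pM2l ?exprn_gt0// ler_expR lerN2 ler_pM2r ?invr_gt0// ler_nat.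
(* Summing over blocks gives [k] exponentials, at most the [2 * k] of the claim. *)
rewrite sumr_const card_ord -[leLHS]mulr_natl ler_wpM2r ?expR_ge0//.
by rewrite ler_peMl// ler1n.
Qed.
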